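(* Let $\Gamma$ be a splice diagram with $n$ leaves satisfying the edge determinant and semigroup conditions and let $\mathcal{S}(\Gamma)$ be a splice type system for $\Gamma$. Let $\tau$ be a positive-dimensional proper face of $\mathbb{R}_{\ge0}^n$, let $\lambda\in L_\tau$, and let $v$ be the unique node of $\Gamma$ adjacent to $\lambda$. Then: (1) if $\dim\tau=1$, then $\mathrm{Trop}^+(\mathcal{S}(\Gamma),\tau)\subseteq\mathbb{R}_{>0}\,\pi_\tau(w_v)$; (2) if $\dim\tau\ge2$, then $\mathrm{Trop}^+(\mathcal{S}(\Gamma),\tau)=\emptyset$.
   Context: A splice diagram is a finite tree $\Gamma$ with at least one vertex of valency $\geq3$ and no vertex of valency $2$; vertices of valency $1$ are leaves, others nodes; $\delta_v$ is the valency of $v$. For each node $v$ and edge $e$ at $v$ a positive integer weight $d_{v,e}$ is given; $d_v=\prod_{e\ni v}d_{v,e}$; $d_{v,u}$ is the weight at $v$ of the edge toward $u$. For distinct vertices $u,v$, $\ell_{u,v}$ is the product of all $d_{w,e}$ with $w$ a node on $[u,v]$ and $e$ an edge at $w$ not in $[u,v]$; $\ell_{v,v}=d_v$. Edge determinant condition: $d_{u,v}d_{v,u}>\ell_{u,v}$ for every edge between nodes. Semigroup condition: for each node $v$ and edge $e$ at $v$, $d_v\in\sum_{\mu\in L(v,e)}\mathbb{N}\ell_{v,\mu}$, $L(v,e)$ the leaves $\mu$ with $e\subseteq[v,\mu]$. Variables $z_\mu$ and standard basis vectors $w_\mu$ of $\mathbb{R}^n$ are indexed by leaves; $w_u=\sum_\mu\ell_{u,\mu}w_\mu$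 for nodes $u$. Fix $\alpha_{v,e,\mu}\in\mathbb{N}$ with $d_v=\sum\alpha_{v,e,\mu}\ell_{v,\mu}$, $z^{m_{v,e}}=\prod z_\mu^{\alpha_{v,e,\mu}}$. A splice type system is a family $F_{v,i}=f_{v,i}+g_{v,i}\in\mathbb{C}\{z_\mu\}$ ($v$ node, $1\le i\le\delta_v-2$), $f_{v,i}=\sum_{e\ni v}c_{v,e,i}z^{m_{v,e}}$ with all maximal minors of $(c_{v,e,i})_{e,i}$ nonzero, $g_{v,i}$ convergent with every exponent $m$ satisfying $w_v\cdot m>d_v$ and $w_u\cdot m>\ell_{u,v}$ for nodes $u\neq v$. For a face $\tau$ of dimension $k$, $L_\tau$ is the set of leaves $\mu$ with $w_\mu$ a ray of $\tau$, and $\pi_\tau:\mathbb{R}^n\to\mathbb{R}^{n-k}$ is the projection forgetting the coordinates indexed by $L_\tau$. The $\tau$-truncation $F^\tau$ of a series $F$ is obtained by setting $z_\mu=0$ for all $\mu\in L_\tau$, viewed in $\mathcal{O}_\tau=\mathbb{C}\{z_\mu:\mu\notin L_\tau\}$. Let $J_\tau\subseteq\mathcal{O}_\tau$ be generated by the $F_{v,i}^\tau$. For $w\in\mathbb{R}_{\ge0}^{n-k}$, $\mathrm{in}_w(f)$ is the sum of terms of $f$ of minimal $w$-weight, and $\mathrm{in}_w(J_\tau)$ the ideal of $\mathcal{O}_\tau$ generated by all $\mathrm{in}_w(f)$, $f\in J_\tau$. Then $\mathrm{Trop}^+(\mathcal{S}(\Gamma),\tau)$ is the set of $w\in\mathbb{R}_{>0}^{n-k}$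 such that $\mathrm{in}_w(J_\tau)$ contains no monomial (the positive local tropicalization of the intersection of the germ with the torus of the coordinate subspace $\{z_\mu=0,\ \mu\in L_\tau\}$). *)

(* Defs.v *)
From HB Require Import structures.
From mathcomp Require Import all_boot all_order all_algebra complex.
From mathcomp Require Import boolp reals.
Set Implicit Arguments. Unset Strict Implicit. Unset Printing Implicit Defensive.
Import Order.TTheory GRing.Theory Num.Theory.
Local Open Scope ring_scope.

Section Tree.
Variable V : finType.
Variable adj : rel V.

Definition simple_path (u v : V) (p : seq V) : bool :=
  [&& path adj u p, last u p == v & uniq (u :: p)].

Definition is_tree : Prop :=
  symmetric adj /\ irreflexive adj /\
  (forall u v : V, exists p, simple_path u v p) /\
  (forall (u v : V) p q, simple_path u v p -> simple_path u v q -> p = q).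

Definition on_path (u v w : V) : bool :=
  `[< exists p, simple_path u v p /\ w \in u :: p >].

Definition valency (v : V) : nat := #|[set x | adj v x]|.
Definition is_leaf (v : V) : bool := valency v == 1%N.
Definition is_node (v : V) : bool := (valency v >= 2)%N.

Definition splice_diagram : Prop :=
  is_tree /\ (exists v, (3 <= valency v)%N) /\ (forall v, valency v != 2%N).

(* Weights: d v x = d_{v,e} for the edge e = {v,x} at the node v.            *)
Variable d : V -> V -> nat.

Definition dnode (v : V) : nat := \prod_(x | adj v x) d v x.

Definition ell (u v : V) : nat :=
  if u == v then dnode v
  else \prod_(w | is_node w && on_path u v w)
         \prod_(x | adj w x && ~~ on_path u v x) d w x.

(* edge e = {v,x} at v is contained in [v,mu]  iff  x lies on [v,mu] *)
Definition L_edge (v x : V) : {set V} := [set mu | is_leaf mu & on_path v mu x].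

Definition positive_weights : Prop :=
  forall v x, is_node v -> adj v x -> (0 < d v x)%N.

Definition edge_determinant_condition : Prop :=
  forall u v, is_node u -> is_node v -> adj u v -> (ell u v < d u v * d v u)%N.

Definition semigroup_condition : Prop :=
  forall v x, is_node v -> adj v x ->
    exists a : V -> nat, (forall mu, a mu != 0%N -> mu \in L_edge v x) /\
      dnode v = (\sum_(mu | is_leaf mu) a mu * ell v mu)%N.

Definition wdot (u : V) (m : {ffun V -> nat}) : nat :=
  (\sum_(mu | is_leaf mu) ell u mu * m mu)%N.

End Tree.

(* Only the variables indexed by a set S are actually used (support).        *)
Section Series.
Variable R : realType.
Variable V : finType.

Definition mon := {ffun V -> nat}.
Definition series := mon -> R[i].

Definition mdeg (m : mon) : nat := (\sum_x m x)%N.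

Definition monomial (m : mon) : series := fun m' => if m' == m then 1 else 0.

Definition sadd (f g : series) : series := fun m => f m + g m.
Definition szero : series := fun _ => 0.

Definition smul (f g : series) : series := fun m =>
  \sum_(a : {ffun V -> 'I_(mdeg m).+1} | [forall x, (a x <= m x)%N])
     f [ffun x => nat_of_ord (a x)] * g [ffun x => (m x - a x)%N].

Definition supported (S : {set V}) (f : series) : Prop :=
  forall m, f m != 0 -> forall x, m x != 0%N -> x \in S.

Definition convergent (f : series) : Prop :=
  exists r M : R, 0 < r /\ forall m, `|f m| * ((r ^+ mdeg m)%:C)%C <= (M%:C)%C.

Definition in_O (S : {set V}) (f : series) : Prop := supported S f /\ convergent f.

Definition gen_ideal (S : {set V}) (G : series -> Prop) (f : series) : Prop :=
  exists (k : nat) (h g : 'I_k -> series),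
    (forall j, in_O S (h j)) /\ (forall j, G (g j)) /\
    f = (fun m => \sum_(j < k) smul (h j) (g j) m).

Definition truncate (T : {set V}) (f : series) : series := fun m =>
  if [forall x, (x \in T) ==> (m x == 0%N)] then f m else 0.

Definition rweight (w : V -> R) (m : mon) : R := \sum_x w x * (m x)%:R.

Definition initial (w : V -> R) (f : series) : series := fun m =>
  if `[< forall m', f m' != 0 -> rweight w m <= rweight w m' >] then f m else 0.

Definition initial_ideal (S : {set V}) (w : V -> R) (J : series -> Prop) :
  series -> Prop :=
  gen_ideal S (fun f => exists2 g, J g & f = initial w g).

End Series.

(*  c v x i  : coefficient c_{v,e,i} (e = {v,x}), i < valency v - 2          *)
Section Splice.
Variable R : realType.
Variable V : finType.
Variables (adj : rel V) (d : V -> V -> nat).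
Variables (c : V -> V -> nat -> R[i]) (alpha : V -> V -> mon V)
          (g : V -> nat -> series R V).

Definition leaves : {set V} := [set mu | is_leaf adj mu].

Definition fpart (v : V) (i : nat) : series R V := fun m =>
  \sum_(x | adj v x) c v x i * monomial R (alpha v x) m.

Definition Fsys (v : V) (i : nat) : series R V := sadd (fpart v i) (g v i).

Definition splice_type_system : Prop :=
  (forall v x, is_node adj v -> adj v x ->
     (forall mu, alpha v x mu != 0%N -> mu \in L_edge adj v x) /\
     dnode adj d v = (\sum_(mu | is_leaf adj mu) alpha v x mu * ell adj d v mu)%N) /\
  (forall v (sigma : 'I_(valency adj v - 2) -> V),
     is_node adj v -> injective sigma -> (forall j, adj v (sigma j)) ->
     \det (\matrix_(j, i) c v (sigma j) (nat_of_ord i)) != 0) /\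
  (forall v i, is_node adj v -> (i < valency adj v - 2)%N ->
     in_O leaves (g v i) /\
     forall m, g v i m != 0 ->
       (dnode adj d v < wdot adj d v m)%N /\
       forall u, is_node adj u -> u != v -> (ell adj d u v < wdot adj d u m)%N).

Definition J_tau (T : {set V}) : series R V -> Prop :=
  gen_ideal (leaves :\: T)
    (fun f => exists v i, [/\ is_node adj v, (i < valency adj v - 2)%N &
                             f = truncate T (Fsys v i)]).

(* w in Trop^+(S(Gamma), tau); w is a vector indexed by the leaves outside  *)
(* L_tau = T (its other coordinates are irrelevant)                          *)
Definition trop_pos (T : {set V}) (w : V -> R) : Prop :=
  (forall mu, mu \in leaves :\: T -> 0 < w mu) /\
  ~ (exists m, initial_ideal (leaves :\: T) w (J_tau T) (monomial R m)).

End Splice.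

(* Main.v *)
(** For a node y let N_y be the minimum of w_mu / ell_{y,mu} over the leaves mu
    outside T, and say that y points along an edge if this minimum is attained
    beyond that edge. By the edge determinant condition two adjacent nodes never
    point at each other. If w_mu = N_y ell_{y,mu} for all leaves mu beyond some edge
    e0 at y, the monomial of e0 has weight N_y d_y, and every term of g_{y,i} weighs
    strictly more. Eliminating from the F_{y,i} all edge monomials but those of e0
    and of two further edges shows that, since the initial ideal has no monomial,
    y points along all but at most one of its edges. Induction on branches, starting
    from the leaves, then gives: if y points along e, then w_mu = N_y ell_{y,mu} for
    all leaves mu beyond e; in particular none of them is in T. At the node v
    adjacent to lambda in T, the edge to lambda is not pointed along, so all the
    other ones are: hence T = {lambda} and w is proportional to w_v. *)

Require Import Defs.
From HB Require Import structures.
From mathcomp Require Import all_boot all_order all_algebra complex.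
From mathcomp Require Import boolp reals.
Import Order.TTheory GRing.Theory Num.Theory.
Local Open Scope ring_scope.

Set Implicit Arguments.
Unset Strict Implicit.
Unset Printing Implicit Defensive.

(** * Paths and branches of a tree, and the change of [ell] along an edge *)

Section SplicePaths.
Variables (V : finType) (adj : rel V).
Hypothesis tree : is_tree adj.

Let adjC : symmetric adj. Proof. by case: tree. Qed.
Let adjxx : irreflexive adj. Proof. by case: tree => _ []. Qed.

Lemma tree_simple_path_uniq u v p q :
  simple_path adj u v p -> simple_path adj u v q -> p = q.
Proof. by case: tree => _ [_ [_]]; apply. Qed.

Lemma tree_simple_path_ex u v : exists p, simple_path adj u v p.
Proof. by case: tree => _ [_ [+ _]]; apply. Qed.

Lemma on_pathE u v p w : simple_path adj u v p -> on_path adj u v w = (w \in u :: p).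
Proof.
move=> up; apply/asboolP/idP; last by exists p.
by case=> q [uq]; rewrite (tree_simple_path_uniq up uq).
Qed.

Lemma on_path_refl v w : on_path adj v v w = (w == v).
Proof.
by rewrite (@on_pathE _ _ [::]) ?inE // /simple_path /= eqxx.
Qed.

Lemma on_path_end u v : on_path adj u v v.
Proof.
have [p up] := tree_simple_path_ex u v; rewrite (on_pathE _ up).
by case/and3P: up => _ /eqP <- _; exact: mem_last.
Qed.

Lemma simple_path_cons u x v p : adj u x -> ~~ on_path adj x v u ->
  simple_path adj x v p -> simple_path adj u v (x :: p).
Proof.
move=> ux nu xp; move: nu; rewrite (on_pathE _ xp).
by case/and3P: xp => px lx ax nu; rewrite /simple_path /= ux px lx nu.
Qed.

Lemma on_path_cons u x v w : adj u x -> ~~ on_path adj x v u ->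
  on_path adj u v w = (w == u) || on_path adj x v w.
Proof.
move=> ux nu; have [p xp] := tree_simple_path_ex x v.
by rewrite (on_pathE _ (simple_path_cons ux nu xp)) inE (on_pathE _ xp).
Qed.

Lemma on_path_step_back u x v : adj u x -> on_path adj u v x -> ~~ on_path adj x v u.
Proof.
move=> ux; have [p up] := tree_simple_path_ex u v; rewrite (on_pathE _ up) inE.
case/orP=> [/eqP xu|xp]; first by move: ux; rewrite xu adjxx.
case/splitPr: xp up => p1 p2 /and3P[].
rewrite cat_path last_cat /= => /and3P[_ _ p2x] l2.
rewrite mem_cat cat_uniq => /and3P[nu _ /and3P[_ nx u2]].
rewrite (@on_pathE _ _ p2); last by rewrite /simple_path p2x l2 /= nx.
by apply: contra nu => ->; rewrite orbT.
Qed.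

Lemma on_path_step_ex u v : u != v -> exists2 x, adj u x & on_path adj u v x.
Proof.
move=> uv; have [p up] := tree_simple_path_ex u v.
case: p up => [|x p] up; first by case/and3P: up uv => _ /= ->.
by exists x; [case/and3P: up => /andP[] | rewrite (on_pathE _ up) !inE eqxx orbT].
Qed.

Lemma on_path_step_uniq u v x y : adj u x -> adj u y ->
  on_path adj u v x -> on_path adj u v y -> x = y.
Proof.
move=> ux uy xv yv.
have [p xp] := tree_simple_path_ex x v; have [q yq] := tree_simple_path_ex y v.
have := tree_simple_path_uniq (simple_path_cons ux (on_path_step_back ux xv) xp)
  (simple_path_cons uy (on_path_step_back uy yv) yq).
by case.
Qed.

Lemma on_path_edge x y v : adj x y -> on_path adj x v y || on_path adj y v x.
Proof.
move=> xy; case: (boolP (on_path adj y v x)) => [_|nx]; first by rewrite orbT.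
rewrite (on_path_cons _ xy nx); suff -> : on_path adj y v y by rewrite !orbT.
by have [p yp] := tree_simple_path_ex y v; rewrite (on_pathE _ yp) mem_head.
Qed.

Definition branch (y x : V) : {set V} := [set u | on_path adj y u x].

(** At least [x] is lost; the size of a branch is the induction measure of [toward_tight]. *)
Lemma branch_proper y x z : adj y x -> adj x z -> z != y ->
  (#|branch x z| < #|branch y x|)%N.
Proof.
move=> yx xz zy; apply/proper_card/properP; split.
  apply/subsetP=> u; rewrite !inE => xuz.
  suff nxy : ~~ on_path adj x u y.
    by have := on_path_edge u yx; rewrite (negbTE nxy) orbF.
  apply: contra zy => xuy; apply/eqP.
  by apply: (on_path_step_uniq xz _ xuz xuy); rewrite adjC.
exists x; rewrite inE ?on_path_end // on_path_refl.
by apply: contraL xz => /eqP ->; rewrite adjxx.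
Qed.

Lemma valency_gt1 x y z : adj x y -> adj x z -> y != z -> (1 < valency adj x)%N.
Proof.
move=> xy xz yz; have <- : #|[set y; z]| = 2%N by rewrite cards2 yz.
by apply/subset_leq_card/subsetP=> u; rewrite !inE => /orP[]/eqP->.
Qed.

Lemma on_path_leaf y x v : adj y x -> is_leaf adj x -> on_path adj y v x -> v = x.
Proof.
move=> yx /eqP lx yvx; apply/eqP; apply: contraT; rewrite eq_sym => xv.
have [z xz xvz] := on_path_step_ex xv.
have : y != z.
  apply: contraNneq (on_path_step_back yx yvx) => -> //.
by move/(valency_gt1 (etrans (adjC x y) yx) xz); rewrite lx.
Qed.

Variable d : V -> V -> nat.

(* dnode and ell are products for the ring structure of nat, hence hidden from the
   lemmas on muln until restated. *)
Lemma dnodeE v : dnode adj d v = (\prod_(x | adj v x) d v x)%N.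
Proof. by []. Qed.

Lemma ell_neqE u v : u != v -> ell adj d u v =
  (\prod_(w | is_node adj w && on_path adj u v w)
     \prod_(x | adj w x && ~~ on_path adj u v x) d w x)%N.
Proof. by rewrite /ell => /negbTE ->. Qed.

(** The factor that an end [x] of a path contributes to [ell] when the path's edge at [x] leads to
    [y]. *)
Definition cowt (x y : V) : nat := (\prod_(z | adj x z && (z != y)) d x z)%N.

Lemma ell_edge x y : is_node adj x -> is_node adj y -> adj x y ->
  ell adj d x y = (cowt x y * cowt y x)%N.
Proof.
move=> nx ny xy.
have xNy : x != y by apply: contraL xy => /eqP->; rewrite adjxx.
have onE w : on_path adj x y w = (w == x) || (w == y).
  by rewrite (on_path_cons _ xy) ?on_path_refl.
rewrite ell_neqE // (bigD1 x) ?onE ?nx ?eqxx //=.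
move E: (cowt x y * cowt y x)%N => r; rewrite [X in (_ * X)%N](bigD1 y) /=; last first.
  by rewrite onE ny eqxx orbT eq_sym.
rewrite -{}E.
rewrite [X in (_ * (_ * X))%N]big1 ?muln1 => [|w]; last first.
  by rewrite onE => /andP[/andP[/andP[_ /orP[]/eqP->]]]; rewrite eqxx.
congr (_ * _)%N; apply: eq_bigl => z; rewrite onE negb_or.
  by case: (eqVneq z x) => // ->; rewrite adjxx.
by case: (eqVneq z y) => [->|]; rewrite ?adjxx ?andbT.
Qed.

(** The two paths differ only by [x]: the longer one gains the factor [cowt x y] and loses [d y x],
    since its edge at [y] toward [x] is no longer off the path. *)
Lemma ell_step x y mu : is_node adj x -> is_node adj y -> is_leaf adj mu ->
  adj x y -> on_path adj x mu y ->
  (ell adj d x mu * d y x = cowt x y * ell adj d y mu)%N.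
Proof.
move=> nx ny /eqP lmu xy xmuy.
have nNmu z : is_node adj z -> z != mu.
  by move=> nz; apply/negP => /eqP zmu; move: nz; rewrite zmu /is_node lmu.
have nyx := on_path_step_back xy xmuy.
have onE w := on_path_cons w xy nyx.
have yx : adj y x by rewrite adjC.
have yy : on_path adj y mu y.
  by have := xmuy; rewrite onE => /orP[/eqP yEx|//]; move: xy; rewrite yEx adjxx.
rewrite !ell_neqE ?nNmu // (bigD1 x) ?onE ?nx ?eqxx //= -mulnA.
congr (_ * _)%N.
  apply: eq_bigl => z; case xz: (adj x z) => //=; congr (~~ _).
  apply/idP/eqP => [xmuz|->//]; exact: (on_path_step_uniq xz xy xmuz xmuy).
rewrite (eq_bigl (fun w => is_node adj w && on_path adj y mu w)); last first.
  move=> w; rewrite onE -andbA; congr (_ && _).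
  by case: (eqVneq w x) => [->|]; rewrite ?andbT ?(negbTE nyx).
rewrite (bigD1 y) /= ?ny ?yy // [RHS](bigD1 y) /= ?ny ?yy //.
rewrite mulnAC; congr (_ * _)%N.
  rewrite [RHS](bigD1 x) /= ?yx ?nyx // mulnC; congr (_ * _)%N.
  by apply: eq_bigl => z; rewrite onE negb_or -!andbA; congr (_ && _); rewrite andbC.
(* A path vertex adjacent to [x] is the first step from [x] toward [mu], hence [y]; so at any other
   [w] the same edges are off both paths. *)
apply: eq_bigr => w /andP[/andP[nw ymuw] wy]; apply: eq_bigl => z.
case wz: (adj w z) => //=; rewrite onE negb_or.
case: (eqVneq z x) => //= zx; rewrite zx in wz *.
rewrite (_ : w = y) ?eqxx // in wy.
apply: (on_path_step_uniq (u := x) (v := mu)) => //; first by rewrite adjC.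
by rewrite onE ymuw orbT.
Qed.

Lemma dnode_gt0 u : positive_weights adj d -> is_node adj u -> (0 < dnode adj d u)%N.
Proof. by move=> dpos nu; rewrite dnodeE prodn_cond_gt0 // => x ux; exact: dpos. Qed.

Lemma ell_gt0 u v : positive_weights adj d -> is_node adj u -> (0 < ell adj d u v)%N.
Proof.
move=> dpos nu; case: (eqVneq u v) => [<-|uv]; rewrite ?(ell_neqE uv).
  by rewrite /ell eqxx; exact: dnode_gt0.
apply: prodn_cond_gt0 => w /andP[nw _]; apply: prodn_cond_gt0 => x /andP[wx _].
exact: dpos.
Qed.

End SplicePaths.

(** * Constant series as scalars, and monomials as initial forms *)

Section ConstantSeries.
Variables (R : realType) (V : finType).

Definition constant_series (b : R[i]) : series R V :=
  fun m => if m == [ffun=> 0%N] then b else 0.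

Lemma constant_series_in_O (S : {set V}) b : in_O S (constant_series b).
Proof.
split=> [m|].
  rewrite /constant_series; case: (m =P _) => [-> _ x|_]; first by rewrite ffunE.
  by rewrite eqxx.
exists 1, (Normc.normc b); split=> // m; rewrite expr1n mulr1 /constant_series.
by case: (m =P _) => // _; rewrite normr0; exact: (normr_ge0 b).
Qed.

Lemma smul_constant_series b (f : series R V) m :
  smul (constant_series b) f m = b * f m.
Proof.
(* Only the splitting with zero exponent in the first factor meets the support of a constant. *)
rewrite /smul (bigD1 [ffun=> ord0]) /=; last by apply/forallP => x; rewrite ffunE.
rewrite big1 ?addr0 => [|a /andP[_ aN0]].
  rewrite /constant_series ifT; last by apply/eqP/ffunP => x; rewrite !ffunE.
  by congr (_ * f _); apply/ffunP => x; rewrite !ffunE subn0.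
rewrite /constant_series ifF ?mul0r //; apply: contraNF aN0 => /eqP/ffunP a0.
by apply/eqP/ffunP => x; apply: val_inj; have := a0 x; rewrite !ffunE.
Qed.

Lemma gen_ideal_monomial_initial (S : {set V}) (w : V -> R) (J : series R V -> Prop)
    (f : series R V) (m0 : mon V) :
  J f -> f m0 = 1 -> (forall m, f m != 0 -> m != m0 -> rweight w m0 < rweight w m) ->
  initial_ideal S w J (monomial R m0).
Proof.
move=> Jf fm0 wlt; have inE : initial w f = monomial R m0.
  apply/funext => m; rewrite /initial /monomial; case: eqP => [->|/eqP mN].
    rewrite ifT //; apply/asboolP => m' fm'.
    by case: (eqVneq m' m0) => [->//|m'N]; exact/ltW/wlt.
  case: asboolP => // wle; apply/eqP; apply: contraT => fm.
  have := wle m0; rewrite fm0 oner_neq0 => /(_ isT).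
  by rewrite leNgt wlt.
exists 1%N, (fun=> constant_series 1), (fun=> initial w f); split; [|split].
- by move=> _; exact: constant_series_in_O.
- by move=> _; exists f.
- by apply/funext => m; rewrite big_ord1 smul_constant_series mul1r inE.
Qed.

End ConstantSeries.

(** * Linear combinations of the equations at one node *)

Section SpliceSystem.
Variables (R : realType) (V : finType) (adj : rel V) (d : V -> V -> nat).
Variables (c : V -> V -> nat -> R[i]) (alpha : V -> V -> mon V).
Variable g : V -> nat -> series R V.
Hypothesis sys : splice_type_system adj d c alpha g.

Lemma J_tau_combination (T : {set V}) y (b : 'I_(valency adj y - 2) -> R[i]) :
  is_node adj y ->
  J_tau adj c alpha g T (fun m => \sum_j b j * truncate T (Fsys adj c alpha g y j) m).
Proof.
move=> ny; exists _, (fun j => constant_series (b j)).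
exists (fun j => truncate T (Fsys adj c alpha g y (nat_of_ord j))); split; [|split].
- by move=> j; exact: constant_series_in_O.
- by move=> j; exists y, j.
- by apply/funext => m; apply: eq_bigr => j _; rewrite smul_constant_series.
Qed.

(* The maximal minor on the edges other than x1, x2 is invertible. *)
Lemma eliminate_edges y x0 x1 x2 : is_node adj y -> adj y x0 -> adj y x1 -> adj y x2 ->
  x0 != x1 -> x0 != x2 -> x1 != x2 ->
  exists b : 'I_(valency adj y - 2) -> R[i],
    forall x, adj y x -> x != x1 -> x != x2 ->
      \sum_j b j * c y x j = (x == x0)%:R.
Proof.
move=> ny yx0 yx1 yx2 x01 x02 x12.
pose A := [set x | adj y x] :\ x1 :\ x2.
have cardA : (valency adj y - 2)%N = #|A|.
  rewrite /valency (cardsD1 x1) (cardsD1 x2 (_ :\ _)) !inE yx1 yx2 eq_sym x12 /=.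
  by rewrite addnA addKn.
have inA x : (x \in A) = [&& x != x2, x != x1 & adj y x] by rewrite !inE.
pose sigma j : V := enum_val (cast_ord cardA j).
have sigma_inj : injective sigma by move=> i j /enum_val_inj/cast_ord_inj.
have sigmaA j : sigma j \in A by exact: enum_valP.
have sigma_adj j : adj y (sigma j) by have := sigmaA j; rewrite inA => /and3P[].
have sigma_ex x : x \in A -> exists j, x = sigma j.
  move=> xA; exists (cast_ord (esym cardA) (enum_rank_in xA x)).
  by rewrite /sigma cast_ordKV enum_rankK_in.
have [_ [minors _]] := sys.
have := minors y sigma ny sigma_inj sigma_adj; set M := \matrix_(_, _) _ => detM.
have Mu : M \in unitmx by rewrite unitmxE unitfE.
have [|j0 j0E] := sigma_ex x0; first by rewrite inA x02 x01.
(* The column of the inverse at the index [j0] of [x0]: pairing it with the rows of [M] gives a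
   column of the identity. *)
exists (fun j => invmx M j j0) => x yx xx1 xx2.
have [|k ->] := sigma_ex x; first by rewrite inA xx1 xx2.
transitivity ((M *m invmx M) k j0); last by rewrite mulmxV // mxE j0E (inj_eq sigma_inj).
by rewrite mxE; apply: eq_bigr => j _; rewrite mxE mulrC.
Qed.

End SpliceSystem.

(** * Minimising leaves and the edges along which nodes point *)

Section Tropical.
Variables (R : realType) (V : finType) (adj : rel V) (d : V -> V -> nat).
Variables (c : V -> V -> nat -> R[i]) (alpha : V -> V -> mon V).
Variables (g : V -> nat -> series R V) (T : {set V}) (w : V -> R).
Hypotheses (Gamma : splice_diagram adj) (d_pos : positive_weights adj d).
Hypothesis d_edge : edge_determinant_condition adj d.
Hypothesis sys : splice_type_system adj d c alpha g.
Hypotheses (T_leaves : T \subset leaves adj) (T_proper : T != leaves adj).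
Hypothesis w_trop : trop_pos adj c alpha g T w.

Let tree : is_tree adj. Proof. by case: Gamma. Qed.
Let adjC : symmetric adj. Proof. by case: tree. Qed.

Local Notation S := (leaves adj :\: T).
Local Notation ell := (ell adj d).

Let ellR_gt0 y mu : is_node adj y -> 0 < (ell y mu)%:R :> R.
Proof. by move=> ny; rewrite ltr0n ell_gt0. Qed.

Let in_S mu : (mu \in S) = (mu \notin T) && is_leaf adj mu.
Proof. by rewrite !inE. Qed.

(* Division-free form of: mu minimises w_mu / ell_{y,mu} over the leaves outside T. *)
Definition argmin y mu : Prop :=
  mu \in S /\ forall nu, nu \in S -> w mu * (ell y nu)%:R <= w nu * (ell y mu)%:R.

Definition toward y x : Prop := exists2 mu, argmin y mu & on_path adj y mu x.

(** As [argmin] includes membership in [S], this also excludes leaves of [T] beyond [x]. *)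
Definition tight y x : Prop :=
  forall mu, is_leaf adj mu -> on_path adj y mu x -> argmin y mu.

Lemma argmin_ex y : is_node adj y -> exists mu, argmin y mu.
Proof.
move=> ny; have [s0 s0S] : exists s0, s0 \in S.
  apply/set0Pn; apply: contra T_proper; rewrite setD_eq0 => LT.
  by rewrite eqEsubset T_leaves.
pose mu := [arg min_(i < s0 in S) (w i / (ell y i)%:R)]%O.
exists mu; rewrite /mu; case: arg_minP => // {}mu muS le_mu; split=> // nu nuS.
by have := le_mu nu nuS; rewrite ler_pdivrMr ?ellR_gt0 // mulrAC ler_pdivlMr ?ellR_gt0.
Qed.

Lemma argmin_le y mu nu : is_node adj y -> argmin y nu -> mu \in S ->
  w mu * (ell y nu)%:R <= w nu * (ell y mu)%:R -> argmin y mu.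
Proof.
move=> ny [nuS nu_le] muS mu_le; split=> // xi xiS.
rewrite -(ler_pM2r (ellR_gt0 nu ny)) mulrAC.
apply: (le_trans (ler_wpM2r (ler0n _ _) mu_le)).
by rewrite mulrAC [leRHS]mulrAC; apply: ler_wpM2r; [exact: ler0n | exact: nu_le].
Qed.

(** Minimality of [mu] at [x] and of [nu] at [y] combine, after cancelling the weights, to [le_ell].
    By [ell_step] from both ends this becomes [d x y * d y x <= cowt x y * cowt y x], which is
    [ell x y]. *)
Lemma toward_not_both x y : is_node adj x -> is_node adj y -> adj x y ->
  toward x y -> toward y x -> False.
Proof.
move=> nx ny xy [mu [muS mu_le] xmuy] [nu [nuS nu_le] ynux].
have yx : adj y x by rewrite adjC.
have [/andP[_ lmu] /andP[_ lnu]] : (mu \notin T) && is_leaf adj mu /\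
  (nu \notin T) && is_leaf adj nu by rewrite -!in_S.
have Emu := ell_step tree d nx ny lmu xy xmuy.
have Enu := ell_step tree d ny nx lnu yx ynux.
have le_ell : (ell x nu * ell y mu <= ell y nu * ell x mu)%N.
  rewrite -(ler_nat R) !natrM -(ler_pM2l (w_trop.1 mu muS)) !mulrA.
  apply: (le_trans (ler_wpM2r (ler0n _ _) (mu_le nu nuS))).
  by rewrite mulrAC; apply: ler_wpM2r; [exact: ler0n | exact: nu_le].
have := d_edge nx ny xy; rewrite ell_edge // ltnNge => /negP; apply.
have ell_pos : (0 < ell x nu * ell y mu)%N by rewrite muln_gt0 !ell_gt0.
rewrite -(leq_pmul2l ell_pos).
have := leq_mul le_ell (leqnn (d x y * d y x)); rewrite (mulnACA (ell y nu)) Emu Enu.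
by rewrite [X in (_ <= X)%N -> _]mulnACA (mulnC (cowt _ _ y x)) -mulnACA
  [X in (_ <= X)%N]mulnC [X in (_ <= _ * X)%N]mulnC mulnC.
Qed.

(** For leaves beyond [x], [ell y] is [ell x] times the constant [cowt y x / d x y], so the leaves
    minimising at [x] tie with [nu] at [y]. *)
Lemma tight_transfer y x nu : is_node adj y -> is_node adj x -> adj y x ->
  (forall mu, is_leaf adj mu -> on_path adj y mu x -> argmin x mu) ->
  argmin y nu -> on_path adj y nu x -> tight y x.
Proof.
move=> ny nx yx xmin ynu ynux mu lmu ymux.
have [muS _] := xmin mu lmu ymux.
have lnu : is_leaf adj nu by case: (ynu); rewrite in_S => /andP[].
apply: (argmin_le ny ynu muS).
have dxy : 0 < (d x y)%:R :> R by rewrite ltr0n d_pos // adjC.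
rewrite -(ler_pM2r dxy) -!mulrA -!natrM !(ell_step tree) // !natrM.
rewrite (mulrCA (w mu)) (mulrCA (w nu)); apply: ler_wpM2l; first exact: ler0n.
by case: (xmin mu lmu ymux) => _; apply; case: ynu.
Qed.

(** * Weight of a monomial under [w] against its weight at a node *)

Section Weights.
Variables (y mu0 : V) (m : mon V).
Hypotheses (ny : is_node adj y) (y_mu0 : argmin y mu0).
Hypothesis m_supp : forall x, m x != 0%N -> x \in S.

Let wdotE : w mu0 * (wdot adj d y m)%:R = \sum_x w mu0 * (ell y x)%:R * (m x)%:R.
Proof.
rewrite /wdot natr_sum mulr_sumr [RHS](bigID (is_leaf adj)) /= [X in _ + X]big1 ?addr0.
  by apply: eq_bigr => x _; rewrite natrM mulrA.
move=> x nlx; case: (eqVneq (m x) 0%N) => [->|/m_supp]; first by rewrite mulr0.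
by rewrite in_S (negbTE nlx) andbF.
Qed.

Let rweightE : rweight w m * (ell y mu0)%:R =
  \sum_x w x * (ell y mu0)%:R * (m x)%:R.
Proof. by rewrite /rweight mulr_suml; apply: eq_bigr => x _; rewrite mulrAC. Qed.

Let term_le x : w mu0 * (ell y x)%:R * (m x)%:R <= w x * (ell y mu0)%:R * (m x)%:R.
Proof.
case: (eqVneq (m x) 0%N) => [->|/m_supp xS]; first by rewrite !mulr0.
by apply: ler_wpM2r; [exact: ler0n | exact: y_mu0.2].
Qed.

(** Dividing by [ell y mu0], the [w]-weight is at least [N_y] times the node weight; minimality of
    [mu0] gives this variable by variable. *)
Lemma wdot_le_rweight :
  w mu0 * (wdot adj d y m)%:R <= rweight w m * (ell y mu0)%:R.
Proof. by rewrite wdotE rweightE; apply: ler_sum => x _; exact: term_le. Qed.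

Lemma wdot_eq_rweight : (forall x, m x != 0%N -> argmin y x) ->
  w mu0 * (wdot adj d y m)%:R = rweight w m * (ell y mu0)%:R.
Proof.
move=> m_min; rewrite wdotE rweightE; apply: eq_bigr => x _.
case: (eqVneq (m x) 0%N) => [->|mx]; first by rewrite !mulr0.
have [xS x_le] := m_min x mx; congr (_ * _); apply/eqP.
by rewrite eq_le x_le ?y_mu0.2 // y_mu0.1.
Qed.

Lemma wdot_lt_rweight x : m x != 0%N -> ~ argmin y x ->
  w mu0 * (wdot adj d y m)%:R < rweight w m * (ell y mu0)%:R.
Proof.
move=> mx xN; rewrite wdotE rweightE (bigD1 x) //= [ltRHS](bigD1 x) //=.
apply: ltr_leD; last by apply: ler_sum => z _; exact: term_le.
rewrite ltr_pM2r ?ltr0n ?lt0n // ltNge; apply/negP => le_x.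
by apply: xN; apply: (argmin_le ny y_mu0 (m_supp mx)).
Qed.

End Weights.

Let alpha_leaf y x mu : is_node adj y -> adj y x -> alpha y x mu != 0%N ->
  is_leaf adj mu /\ on_path adj y mu x.
Proof.
move=> ny yx; have [+ _] := sys => /(_ y x ny yx)[+ _] => /(_ mu) /[apply].
by rewrite inE => /andP[].
Qed.

Let wdot_alpha y x : is_node adj y -> adj y x -> wdot adj d y (alpha y x) = dnode adj d y.
Proof.
move=> ny yx; have [+ _] := sys => /(_ y x ny yx)[_ ->].
by apply: eq_bigr => mu _; rewrite mulnC.
Qed.

Let alpha_ex y x : is_node adj y -> adj y x -> exists mu, alpha y x mu != 0%N.
Proof.
move=> ny yx; apply/existsP; apply: contraTT (dnode_gt0 d_pos ny).
rewrite negb_exists => /forallP a0; rewrite -(wdot_alpha ny yx) /wdot big1 //.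
by move=> mu _; have := a0 mu; rewrite negbK => /eqP ->; rewrite muln0.
Qed.

(* In the combination of the F_{y,i} killing every edge monomial except those of
   x0, x1, x2, the x0-monomial is the initial form: it has the least possible
   weight, which all the other terms exceed. *)
Lemma toward_of_tight y x0 x1 x2 : is_node adj y -> adj y x0 -> adj y x1 -> adj y x2 ->
  x0 != x1 -> x0 != x2 -> x1 != x2 -> tight y x0 -> toward y x1 \/ toward y x2.
Proof.
move=> ny yx0 yx1 yx2 x01 x02 x12 y_tight.
apply: contrapT => /not_orP[nx1 nx2].
have [mu0 y_mu0] := argmin_ex ny.
have [b bE] := eliminate_edges sys ny yx0 yx1 yx2 x01 x02 x12.
set m0 := alpha y x0.
have m0_min x : m0 x != 0%N -> argmin y x.
  by move=> /(alpha_leaf ny yx0)[]; exact: y_tight.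
have m0_supp x : m0 x != 0%N -> x \in S by move=> /m0_min[].
have m0_weight := wdot_eq_rweight y_mu0 m0_supp m0_min.
rewrite (wdot_alpha ny yx0) in m0_weight.
pose F : series R V := fun m => \sum_j b j * truncate T (Fsys adj c alpha g y j) m.
have F_low (m : mon V) : [forall x, (x \in T) ==> (m x == 0%N)] ->
    rweight w m <= rweight w m0 -> F m = (m == m0)%:R.
  move=> mT m_le.
  have inS x : is_leaf adj x -> m x != 0%N -> x \in S.
    by move=> lx mx; rewrite in_S lx andbT; apply: contra mx => /(implyP (forallP mT x)).
  (* A term of [g] has node weight above [dnode y], hence [w]-weight above that of [m0], which is
     exactly [N_y] times [dnode y]. *)
  have g0 (j : 'I_(valency adj y - 2)) : g y j m = 0.
    apply/eqP; apply: contraT => gm.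
    have [_ [_ /(_ y j ny (ltn_ord j))[[g_supp _] /(_ m gm)[dlt _]]]] := sys.
    have m_supp x : m x != 0%N -> x \in S.
      by move=> mx; apply: inS => //; have := g_supp m gm x mx; rewrite inE.
    have := wdot_le_rweight y_mu0 m_supp.
    rewrite leNgt => /negP[]; apply: le_lt_trans (_ : w mu0 * (dnode adj d y)%:R < _).
      by rewrite m0_weight ler_pM2r ?ellR_gt0.
    by rewrite ltr_pM2l ?ltr_nat //; apply: w_trop.1; case: y_mu0.
  (* If [y] does not point along [x], no variable of this edge monomial is a minimiser, so it is
     strictly heavier than [m0]. *)
  have alphaN x : adj y x -> ~ toward y x -> m == alpha y x = false.
    move=> yx nx; apply/eqP => mE.
    have m_leaf z : m z != 0%N -> is_leaf adj z /\ on_path adj y z x.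
      by rewrite mE; exact: alpha_leaf.
    have m_supp z : m z != 0%N -> z \in S by move=> mz; apply: inS => //; case: (m_leaf z mz).
    have [z mz] := alpha_ex ny yx; rewrite -mE in mz.
    have zN : ~ argmin y z by move=> ?; apply: nx; exists z => //; case: (m_leaf z mz).
    have := wdot_lt_rweight ny y_mu0 m_supp mz zN.
    by rewrite mE wdot_alpha // m0_weight -mE ltr_pM2r ?ellR_gt0 // ltNge m_le.
  have -> : F m = \sum_(x | adj y x) (\sum_j b j * c y x j) * monomial R (alpha y x) m.
    under [RHS]eq_bigr do rewrite mulr_suml.
    rewrite exchange_big /=; apply: eq_bigr => j _.
    rewrite /truncate mT /Fsys /sadd g0 addr0 /fpart mulr_sumr.
    by apply: eq_bigr => x _; rewrite mulrA.
  rewrite (bigD1 x0) //= bE // eqxx mul1r big1 ?addr0 => [|x /andP[yx xx0]].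
    by rewrite /monomial; case: eqP.
  rewrite /monomial; case: (eqVneq x x1) => [->|xx1]; first by rewrite alphaN ?mulr0.
  case: (eqVneq x x2) => [->|xx2]; first by rewrite alphaN ?mulr0.
  by rewrite bE // (negbTE xx0) mul0r.
case: w_trop => _; apply; exists m0.
apply: (@gen_ideal_monomial_initial _ _ _ _ _ F).
- exact: J_tau_combination.
- rewrite F_low ?eqxx //; apply/forallP => x; apply/implyP => xT.
  by apply: contraT => /m0_supp; rewrite in_S xT.
- move=> m Fm mN; rewrite ltNge; apply: contra Fm => m_le.
  have [mT|mT] := boolP [forall x, (x \in T) ==> (m x == 0%N)].
    by rewrite F_low // (negbTE mN).
  by apply/eqP/big1 => j _; rewrite /truncate (negbTE mT) mulr0.
Qed.

(** * Tightness by induction on branches *)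

Lemma toward_leaf y x : adj y x -> is_leaf adj x -> toward y x -> tight y x.
Proof.
move=> yx lx [mu ymu yxmu] nu _ yxnu.
by rewrite (on_path_leaf tree yx lx yxnu) -(on_path_leaf tree yx lx yxmu).
Qed.

Lemma leaf_or_node y x : adj y x -> is_leaf adj x || is_node adj x.
Proof.
move=> yx; have : (0 < valency adj x)%N.
  by apply/card_gt0P; exists y; rewrite inE adjC.
by rewrite /is_leaf /is_node; case: valency => [|[]].
Qed.

Lemma toward_tight y x : is_node adj y -> adj y x -> toward y x -> tight y x.
Proof.
have [n] := ubnP #|branch adj y x|; elim: n => // n IHn in y x *.
rewrite ltnS => le_n ny yx yx_toward.
have /orP[lx|nx] := leaf_or_node yx; first exact: toward_leaf.
have xy : adj x y by rewrite adjC.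
have nxy : ~ toward x y by move=> xy_toward; exact: (toward_not_both nx ny xy).
have IH z : adj x z -> z != y -> toward x z -> tight x z.
  by move=> xz zy; apply: IHn => //; apply: leq_trans (branch_proper tree yx xz zy) le_n.
have x_leaf mu : argmin x mu -> is_leaf adj mu by case; rewrite in_S => /andP[].
have node_leafN u mu : is_node adj u -> is_leaf adj mu -> u != mu.
  by move=> nu /eqP lmu; apply: contraTneq nu => ->; rewrite /is_node lmu.
have [mu0 x_mu0] := argmin_ex nx.
(* Since [x] does not point back at [y], it points along some [z] inside the branch, where the
   induction hypothesis applies. *)
have [z xz xmuz] := on_path_step_ex tree (node_leafN _ _ nx (x_leaf _ x_mu0)).
have xz_toward : toward x z by exists mu0.
have zy : z != y by apply: contra_notN nxy => /eqP <-.
have z_tight := IH z xz zy xz_toward.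
case: yx_toward => nu y_nu ynux; apply: (tight_transfer ny nx yx) y_nu ynux.
move=> mu lmu ymux.
have [u xu xmuu] := on_path_step_ex tree (node_leafN _ _ nx lmu).
have uy : u != y.
  by apply: contraNneq (on_path_step_back tree yx ymux) => <-.
case: (eqVneq z u) xmuu => [<-|zu] xmuu; first exact: z_tight.
(* Elimination with [z] tight and the edges to [u] and [y]: as [x] does not point at [y], it points
   along [u]. *)
have [|//] := toward_of_tight nx xz xu xy zu zy uy z_tight.
by move=> xu_toward; exact: (IH u).
Qed.

(** Some [u] other than [x] is pointed along, hence tight; elimination with [u], [z], [x] then
    leaves only [z]. *)
Lemma all_but_one_tight y x : is_node adj y -> adj y x -> ~ toward y x ->
  forall z, adj y z -> z != x -> tight y z.
Proof.
move=> ny yx nyx z yz zx; apply: toward_tight => //.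
have [mu y_mu] := argmin_ex ny.
have ymu : y != mu.
  case: y_mu; rewrite in_S => /andP[_ /eqP lmu] _.
  by apply: contraTneq ny => ->; rewrite /is_node lmu.
have [u yu ymuu] := on_path_step_ex tree ymu.
have yu_toward : toward y u by exists mu.
have [<-//|uz] := eqVneq u z.
have ux : u != x by apply: contra_notN nyx => /eqP <-.
by have [] := toward_of_tight ny yu yz yx uz ux zx (toward_tight ny yu yu_toward).
Qed.

(** Two adjacent leaves would be the whole tree, leaving no vertex of valency at least 3. *)
Lemma leaf_neighbor_node lambda v : is_leaf adj lambda -> adj lambda v -> is_node adj v.
Proof.
move=> /eqP ll lv; have /orP[/eqP lv1|//] := leaf_or_node lv.
have [_ [[u u3] _]] := Gamma.
have lu : lambda != u by apply: contraTneq u3 => <-; rewrite ll.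
have [x lx lux] := on_path_step_ex tree lu.
have xv : x = v.
  apply/eqP; apply: contraT => xv.
  by have := valency_gt1 lx lv xv; rewrite ll.
have vu : v != u by apply: contraTneq u3 => <-; rewrite lv1.
rewrite {}xv in lux.
have [z vz vuz] := on_path_step_ex tree vu.
have lz : lambda != z.
  by apply: contraNneq (on_path_step_back tree lv lux) => ->.
have vl : adj v lambda by rewrite adjC.
by have := valency_gt1 vl vz lz; rewrite lv1.
Qed.

(** The only leaf beyond the edge to [lambda] is [lambda] itself, which lies in [T]; so [v] does not
    point along it and all its other edges are tight. *)
Lemma argmin_other_leaves lambda v mu : lambda \in T -> adj lambda v ->
  is_leaf adj mu -> mu != lambda -> argmin v mu.
Proof.
move=> lT lv lmu mul.
have ll : is_leaf adj lambda by have := subsetP T_leaves _ lT; rewrite inE.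
have nv := leaf_neighbor_node ll lv; have vl : adj v lambda by rewrite adjC.
have nvl : ~ toward v lambda.
  case=> nu [+ _] vnul; rewrite (on_path_leaf tree vl ll vnul).
  by rewrite in_S lT.
have vmu : v != mu by move/eqP: lmu => lmu; apply: contraTneq nv => ->; rewrite /is_node lmu.
have [z vz vmuz] := on_path_step_ex tree vmu.
apply: (all_but_one_tight nv vl nvl vz) => //.
apply: contraNneq mul => zl; rewrite zl in vmuz.
by rewrite (on_path_leaf tree vl ll vmuz).
Qed.

End Tropical.

Theorem theorem6p13 (R : realType) (V : finType) (adj : rel V) (d : V -> V -> nat)
    (c : V -> V -> nat -> R[i]) (alpha : V -> V -> mon V) (g : V -> nat -> series R V)
    (T : {set V}) (lambda v : V) :
  splice_diagram adj ->
  positive_weights adj d ->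
  edge_determinant_condition adj d ->
  semigroup_condition adj d ->
  splice_type_system adj d c alpha g ->
  (* tau: positive-dimensional proper face of R_{>=0}^n, L_tau = T, dim tau = #|T| *)
  T \subset leaves adj -> T != set0 -> T != leaves adj ->
  lambda \in T -> adj lambda v ->
  ((#|T| = 1)%N ->
     forall w : V -> R, trop_pos adj c alpha g T w ->
       exists2 t : R, 0 < t &
         forall mu, mu \in leaves adj :\: T -> w mu = t * (ell adj d v mu)%:R) /\
  ((2 <= #|T|)%N -> forall w : V -> R, ~ trop_pos adj c alpha g T w).
Proof.
move=> Gamma d_pos d_edge _ sys T_leaves _ T_proper lT lv.
have v_argmin w mu (w_trop : trop_pos adj c alpha g T w) :
    is_leaf adj mu -> mu != lambda -> argmin adj d T w v mu.
  exact: (argmin_other_leaves Gamma d_pos d_edge sys T_leaves T_proper w_trop lT lv).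
split=> [_|T2] w w_trop.
  have nv : is_node adj v.
    by apply: (leaf_neighbor_node Gamma _ lv); have := subsetP T_leaves _ lT; rewrite inE.
  have ell_pos mu : 0 < (ell adj d v mu)%:R :> R by rewrite ltr0n ell_gt0.
  have [mu0 [mu0S mu0_le]] : exists mu0, argmin adj d T w v mu0 by exact: argmin_ex.
  (* The factor is the minimal ratio [N_v], which every leaf outside [T] attains. *)
  exists (w mu0 / (ell adj d v mu0)%:R); first by rewrite divr_gt0 // w_trop.1.
  move=> mu muS; have /setDP[lmu muT] := muS; rewrite inE in lmu.
  have mul : mu != lambda by apply: contraNneq muT => ->.
  have [_ mu_le] := v_argmin w mu w_trop lmu mul.
  have ell_neq0 := lt0r_neq0 (ell_pos mu0).
  apply: (mulIf ell_neq0); rewrite [w mu0 / _ * _]mulrAC divfK //; apply/eqP.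
  rewrite eq_le mu_le //=.
  exact: mu0_le.
(* A second leaf of [T] would be a minimiser at [v], hence outside [T]. *)
have [mu muT mul] : exists2 mu, mu \in T & mu != lambda.
  move: T2; rewrite (cardsD1 lambda) lT => /card_gt0P[mu].
  by rewrite !inE => /andP[]; exists mu.
have lmu : is_leaf adj mu by have := subsetP T_leaves _ muT; rewrite inE.
by case: (v_argmin w mu w_trop lmu mul); rewrite inE muT.
Qed.
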